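(* For every integer $n \ge 3$, we have $\chi'_{st}(C_5 \,\square\, P_n) = 6$ if $n \in \{3,4,5,6\}$, and $\chi'_{st}(C_5 \,\square\, P_n) = 7$ if $n \ge 7$.
   Context: A star edge-coloring of a graph $G$ is a proper edge-coloring of $G$ in which there is no bichromatic path and no bichromatic cycle of length four (i.e., with four edges). The star chromatic index $\chi'_{st}(G)$ is the minimum number of colors in a star edge-coloring of $G$. $C_m$ denotes the cycle on $m$ vertices and $P_n$ the path on $n$ vertices. $G \,\square\, H$ denotes the Cartesian product: vertex set $V(G)\times V(H)$, with $(u,v)(u',v')$ an edge iff either $uu'\in E(G)$ and $v=v'$, or $u=u'$ and $vv'\in E(H)$. *)

(* Defs.v *)
From mathcomp Require Import all_boot.
Set Implicit Arguments.
Unset Strict Implicit.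
Unset Printing Implicit Defensive.

Record sgraph := SGraph {
  vertex :> finType;
  adj : rel vertex;
  adj_sym : symmetric adj;
  adj_irrefl : irreflexive adj }.

Definition edges (G : sgraph) : {set {set G}} :=
  [set [set p.1; p.2] | p : G * G & adj p.1 p.2].

Definition edge (G : sgraph) : finType := {e : {set G} | e \in edges G}.

Section StarEdgeColoring.
Variable G : sgraph.
Implicit Types (x : G) (p : seq G) (es : seq (edge G)).

(* [es] lists, in order, the edges joining consecutive vertices of [x :: p]. *)
Definition edges_along x p es : bool :=
  map val es == pairmap (fun y z => [set y; z]) x p.

Definition is_path4 es : bool :=
  [exists x : G, exists p : 4.-tuple G, uniq (x :: p) && edges_along x p es].

Definition is_cycle4 es : bool :=
  [exists x : G, exists p : 3.-tuple G,
     uniq (x :: p) && edges_along x (rcons p x) es].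

Section Coloring.
Variables (k : nat) (c : {ffun edge G -> 'I_k}).

Definition proper_edge_coloring : bool :=
  [forall e : edge G, forall f : edge G,
     (e != f) && (val e :&: val f != set0) ==> (c e != c f)].

Definition bichromatic es : bool := size (undup (map c es)) == 2.

Definition star_edge_coloring : bool :=
  proper_edge_coloring &&
  [forall es : 4.-tuple (edge G),
     is_path4 es || is_cycle4 es ==> ~~ bichromatic es].

End Coloring.

Definition star_edge_colorable (k : nat) : bool :=
  [exists c : {ffun edge G -> 'I_k}, star_edge_coloring c].

Lemma set2_eqE (T : finType) (a b u v : T) :
  [set a; b] = [set u; v] -> (a == u) && (b == v) || (a == v) && (b == u).
Proof.
move=> E; move: (set21 a b) (set22 a b) (set21 u v) (set22 u v).
rewrite {1 2}E -{3 4}E !inE.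
by do 4![case/orP=> /eqP ?]; subst; rewrite ?eqxx ?orbT.
Qed.

Lemma edges_along_uniq (es : 4.-tuple (edge G)) :
  is_path4 es || is_cycle4 es -> uniq es.
Proof.
have neq a b c d (U : bool) : U ->
    ((a == c) && (b == d) || (a == d) && (b == c) -> ~~ U) ->
    [set a; b] != [set c; d] :> {set G}.
  by move=> HU F; apply/eqP=> /set2_eqE/F; rewrite HU.
move=> H; rewrite -(map_inj_uniq val_inj).
case/orP: H => /existsP[x /existsP[p /andP[U /eqP ->]]]; move: U.
  case: p => -[|a [|b [|c [|d []]]]] //= _; rewrite !inE !negb_or => U.
  by rewrite andbT -!andbA; apply/and5P; split; rewrite -?andbA;
    try (apply/andP; split); apply: (neq _ _ _ _ _ U);
    case/orP=> /andP[/eqP ? /eqP ?]; subst; rewrite !eqxx ?andbF.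
case: p => -[|a [|b [|c []]]] //= _; rewrite !inE !negb_or => U.
by rewrite andbT -!andbA; apply/and5P; split; rewrite -?andbA;
  try (apply/andP; split); apply: (neq _ _ _ _ _ U);
  case/orP=> /andP[/eqP ? /eqP ?]; subst; rewrite !eqxx ?andbF.
Qed.

Lemma star_edge_colorable_ex : exists k, star_edge_colorable k.
Proof.
exists #|edge G|; apply/existsP; exists [ffun e => enum_rank e].
have inj : injective [ffun e : edge G => enum_rank e].
  by move=> e f; rewrite !ffunE => /enum_rank_inj.
apply/andP; split.
  apply/forallP=> e; apply/forallP=> f; apply/implyP=> /andP[nef _].
  by rewrite (inj_eq inj).
apply/forallP=> es; apply/implyP=> /edges_along_uniq U.
by rewrite /bichromatic undup_id ?map_inj_uniq // size_map size_tuple.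
Qed.

Definition star_chromatic_index : nat := ex_minn star_edge_colorable_ex.

End StarEdgeColoring.

Section CycleGraph.
Variable m : nat.

(* The cycle on m vertices when m >= 3; the disequality only matters for the
   degenerate m = 1, where it removes the loop. *)
Definition cycle_adj : rel 'I_m :=
  fun i j => (i != j) && ((i.+1 %% m == j) || (j.+1 %% m == i)).

Lemma cycle_adj_sym : symmetric cycle_adj.
Proof. by move=> i j; rewrite /cycle_adj /= eq_sym orbC. Qed.

Lemma cycle_adj_irrefl : irreflexive cycle_adj.
Proof. by move=> i; rewrite /cycle_adj /= eqxx. Qed.

Definition cycle_graph : sgraph := SGraph cycle_adj_sym cycle_adj_irrefl.

End CycleGraph.

Section PathGraph.
Variable n : nat.

Definition path_adj : rel 'I_n := fun i j => (i.+1 == j) || (j.+1 == i).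

Lemma path_adj_sym : symmetric path_adj.
Proof. by move=> i j; rewrite /path_adj /= orbC. Qed.

Lemma path_adj_irrefl : irreflexive path_adj.
Proof. by move=> i; rewrite /path_adj /= eqn_leq ltnn. Qed.

Definition path_graph : sgraph := SGraph path_adj_sym path_adj_irrefl.

End PathGraph.

Section CartesianProduct.
Variables G H : sgraph.

Definition cart_adj : rel (G * H) :=
  fun u v => adj u.1 v.1 && (u.2 == v.2) || (u.1 == v.1) && adj u.2 v.2.

Lemma cart_adj_sym : symmetric cart_adj.
Proof.
move=> u v; rewrite /cart_adj /= adj_sym (eq_sym u.1) (eq_sym u.2).
by rewrite (adj_sym u.2).
Qed.

Lemma cart_adj_irrefl : irreflexive cart_adj.
Proof. by move=> u; rewrite /cart_adj /= !adj_irrefl andbF. Qed.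

Definition cart_prod : sgraph := SGraph cart_adj_sym cart_adj_irrefl.

End CartesianProduct.

(* Main.v *)
Require Import Defs.
From mathcomp Require Import all_boot.
Set Implicit Arguments.
Unset Strict Implicit.
Unset Printing Implicit Defensive.

(** In a triangle-free graph, a star edge-coloring is a symmetric function on
adjacent pairs for which no non-backtracking walk with edges e1 e2 e3 e4 has
color pattern a b a b, and no two consecutive edges of such a walk have the
same color.  This condition pulls back along locally injective homomorphisms.

Upper bounds: an explicit 6-coloring of C_5 x P_6 restricts to all shorter
paths, and an explicit 7-coloring of C_5 x C_3 pulls back to every C_5 x P_n.

Lower bounds: a backtracking search, which never tries two colors that have not
occurred yet, finds no 5-coloring of C_5 x P_3 and no 6-coloring of C_5 x P_7.
In the second case let H be the set of colors of the middle layer.  Either a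
color is repeated on this layer, by symmetry on its edges 0 and 2; or the layer
is rainbow and one of the ten edges leaving it has a color outside H, by
symmetry the upward edge at vertex 0; or it is rainbow and all ten edges
leaving it have colors in H.  The last two cases are already impossible in the
five middle layers. *)

(** * Colorings as functions on adjacent pairs *)

(** The ends [x] and [v] of the walk may coincide, so the last condition covers paths and 4-cycles
    at once. Values off [e] are unconstrained. *)
Definition star_fun (T : eqType) (e : rel T) (k : nat) (f : T -> T -> nat) :=
  [/\ forall x y, e x y -> f x y = f y x,
      forall x y, e x y -> f x y < k,
      forall x y z, e x y -> e y z -> x != z -> f x y != f y z
    & forall x y z u v, e x y -> e y z -> e z u -> e u v ->
        x != z -> y != u -> z != v -> f x y = f z u -> f y z != f u v].

(** Local injectivity sends non-backtracking walks to non-backtracking walks. *)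
Lemma star_fun_pullback (T U : eqType) (e : rel T) (e' : rel U) k f
    (h : U -> T) :
    (forall x y, e' x y -> e (h x) (h y)) ->
    (forall x y z, e' x y -> e' y z -> x != z -> h x != h z) ->
  star_fun e k f -> star_fun e' k (fun x y => f (h x) (h y)).
Proof.
move=> hom inj [fC fk fP fS]; split.
- by move=> x y /hom; apply: fC.
- by move=> x y /hom; apply: fk.
- by move=> x y z xy yz xz; apply: fP; [exact: hom..|exact: inj xy yz xz].
- move=> x y z u v xy yz zu uv xz yu zv.
  by apply: fS; [exact: hom..|exact: inj xy yz _|exact: inj yz zu _
    |exact: inj zu uv _].
Qed.

Lemma star_fun_mono (T : eqType) (e : rel T) k k' f :
  k <= k' -> star_fun e k f -> star_fun e k' f.
Proof.
by move=> kk' [fC fk fP fS]; split=> // x y /fk fxy; apply: leq_trans kk'.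
Qed.

(** * Edge colorings versus star functions *)

Definition triangle_free (G : sgraph) :=
  forall x y z : G, adj x y -> adj y z -> ~~ adj x z.

Section EdgeColoringFun.
Variable G : sgraph.
Implicit Types x y z : G.

Lemma adj_neq x y : adj x y -> x != y.
Proof. by apply: contraTneq => ->; rewrite adj_irrefl. Qed.

Lemma set2_edges x y : adj x y -> [set x; y] \in edges G.
Proof. by move=> xy; apply/imsetP; exists (x, y); rewrite ?inE. Qed.

Definition edge_of_adj x y (xy : adj x y) : edge G :=
  Sub [set x; y] (set2_edges xy).

Section ToFun.
Variables (k : nat) (c : {ffun edge G -> 'I_k}).

Definition pair_color x y : nat :=
  if @insub _ _ (edge G) [set x; y] is Some e then c e else 0.

Lemma pair_colorE x y (xy : adj x y) : pair_color x y = c (edge_of_adj xy).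
Proof.
rewrite /pair_color insubT ?set2_edges // => h.
by congr (val (c _)); apply: val_inj.
Qed.

(** Without triangles, a non-backtracking walk of four edges is a path, or a 4-cycle if its ends
    coincide. *)
Lemma pair_color_star : triangle_free G -> star_edge_coloring c ->
  star_fun (@adj G) k pair_color.
Proof.
move=> tf /andP[/forallP pr /forallP st].
have neq x y z (xy : adj x y) (yz : adj y z) : x != z ->
    c (edge_of_adj xy) != c (edge_of_adj yz).
  move=> xz; move/forallP/(_ (edge_of_adj yz))/implyP: (pr (edge_of_adj xy)).
  apply; apply/andP; split; last first.
    by apply/set0Pn; exists y; rewrite !inE eqxx orbT.
  apply/eqP=> /(congr1 val)/= /set2_eqE; rewrite (negPf xz) orbF.
  by case/andP=> /eqP xy'; rewrite xy' adj_irrefl in xy.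
split.
- by move=> x y _; rewrite /pair_color setUC.
- by move=> x y xy; rewrite (pair_colorE xy).
- move=> x y z xy yz xz; rewrite (pair_colorE xy) (pair_colorE yz).
  exact: neq.
move=> x y z u v xy yz zu uv xz yu zv.
rewrite (pair_colorE xy) (pair_colorE yz) (pair_colorE zu) (pair_colorE uv).
move=> /val_inj E1; apply/eqP=> /val_inj E2.
pose es := [tuple edge_of_adj xy; edge_of_adj yz; edge_of_adj zu;
                  edge_of_adj uv].
have xu : x != u.
  by apply: contraTneq (tf _ _ _ xy yz) => ->; rewrite negbK adj_sym.
have yv : y != v.
  by apply: contraTneq (tf _ _ _ yz zu) => ->; rewrite negbK adj_sym.
have n1 := adj_neq xy; have n2 := adj_neq yz; have n3 := adj_neq zu.
have n4 := adj_neq uv.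
have bi : bichromatic c es.
  rewrite /bichromatic /= -E1 -E2 !inE eqxx /= !orbT ?eqxx.
  by rewrite (negPf (neq _ _ _ xy yz xz)) orbT.
have /implyP/(_ _)/negP := st es; apply=> //.
case: (eqVneq x v) => [xv|xv]; apply/orP; [right|left].
  apply/existsP; exists x; apply/existsP; exists [tuple y; z; u].
  rewrite /= !inE !negb_or n1 xz xu n2 yu n3 /=.
  by rewrite /edges_along /= -xv.
apply/existsP; exists x; apply/existsP; exists [tuple y; z; u; v].
by rewrite /= !inE !negb_or n1 xz xu xv n2 yu yv n3 zv n4 /edges_along /=.
Qed.
End ToFun.

Section OfFun.
Variables (k : nat) (f : G -> G -> nat).
Hypothesis fS : star_fun (@adj G) k.+1 f.

(** [pick] orients the edge arbitrarily; the symmetry of [f] makes the choice immaterial. *)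
Definition fun_coloring : {ffun edge G -> 'I_k.+1} :=
  [ffun e => if [pick p : G * G | adj p.1 p.2 && (val e == [set p.1; p.2])]
     is Some p then inord (f p.1 p.2) else ord0].

Lemma fun_coloringE x y (e : edge G) :
  adj x y -> val e = [set x; y] -> fun_coloring e = f x y :> nat.
Proof.
case: fS => fC fk _ _ xy ee; rewrite ffunE; case: pickP => [[a b]|] /=.
  case/andP=> /[dup] /fk fab ab; rewrite ee inordK // => /eqP/set2_eqE.
  by case/orP=> /andP[/eqP-> /eqP->] //; rewrite fC.
by move/(_ (x, y)); rewrite /= xy ee eqxx.
Qed.

Lemma edgeP (e : edge G) :
  exists2 p : G * G, adj p.1 p.2 & val e = [set p.1; p.2].
Proof.
by case/imsetP: (valP e) => p; rewrite inE => pp ->; exists p.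
Qed.

Lemma set2_edge_adj x y (e : edge G) : val e = [set x; y] -> adj x y.
Proof.
have [[a b] /= ab ->] := edgeP e; case/set2_eqE/orP=> /andP[/eqP <- /eqP <-] //.
by rewrite adj_sym.
Qed.

Lemma fun_coloring_star : star_edge_coloring fun_coloring.
Proof.
case: (fS) => fC fk fP fQ; apply/andP; split.
  apply/forallP=> e; apply/forallP=> e'; apply/implyP=> /andP[ne /set0Pn[y]].
  have incident (d : edge G) :
      y \in val d -> exists2 x, adj x y & val d = [set x; y].
    have [[a b] /= ab dE] := edgeP d; rewrite dE !inE.
    by case/orP=> /eqP->; [exists b; rewrite 1?adj_sym // setUC|exists a].
  rewrite inE => /andP[/incident[x xy eE] /incident[z zy e'E]].
  have xz : x != z.
    by apply: contraNneq ne => xz; apply/eqP/val_inj; rewrite eE e'E xz.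
  rewrite -(inj_eq val_inj) /= (fun_coloringE xy) //.
  rewrite adj_sym in zy; rewrite (fun_coloringE zy) ?e'E 1?setUC //.
  exact: fP.
apply/forallP=> -[[|e1 [|e2 [|e3 [|e4 []]]]] // szE].
apply/implyP=> /= H.
(* Paths and 4-cycles are both read as non-backtracking walks, with [v = x] for a cycle. *)
suff [x [y [z [u [v [[E1 E2 E3 E4] xz yu zv]]]]]] :
  exists x y z u v, [/\ [/\ val e1 = [set x; y], val e2 = [set y; z],
    val e3 = [set z; u] & val e4 = [set u; v]], x != z, y != u & z != v].
  have xy := set2_edge_adj E1; have yz := set2_edge_adj E2.
  have zu := set2_edge_adj E3; have uv := set2_edge_adj E4.
  rewrite /bichromatic /= !inE -!(inj_eq val_inj) /=.
  rewrite (fun_coloringE xy E1) (fun_coloringE yz E2).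
  rewrite (fun_coloringE zu E3) (fun_coloringE uv E4).
  (* Consecutive edges differ in color, so two colors on four edges would have to alternate, which
     [fQ] excludes. *)
  have p1 := fP _ _ _ xy yz xz; have p2 := fP _ _ _ yz zu yu.
  have p3 := fP _ _ _ zu uv zv; have := fQ _ _ _ _ _ xy yz zu uv xz yu zv.
  rewrite (negPf p1) (negPf p2) (negPf p3) /=.
  case: (eqVneq (f x y) (f z u)) => [E /(_ E)/negPf->|_ _] /=.
    by case: (f x y == f u v).
  case: (eqVneq (f x y) (f u v)) => E; last by case: (f y z == f u v).
  case: (eqVneq (f y z) (f u v)) => // E'.
  by rewrite E E' eqxx in p1.
case/orP: H => /existsP[x /existsP[[[|y [|z [|u [|v []]]]] // szp]]] /andP[U];
  move: U; rewrite /= !inE !negb_or -!andbA => U; move: U.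
  case/and5P=> _ xz _ _ /and5P[_ yu _ _ /and3P[zv _ _]] /eqP[E1 E2 E3 E4].
  by exists x, y, z, u, v; rewrite zv.
case/and5P=> _ xz _ _ /and3P[yu _ _] /eqP[E1 E2 E3 E4].
by exists x, y, z, u, x; split=> //; rewrite eq_sym.
Qed.
End OfFun.

Lemma star_edge_colorable_of_fun k f :
  star_fun (@adj G) k.+1 f -> star_edge_colorable G k.+1.
Proof.
move=> fS; apply/existsP; exists (fun_coloring k f).
exact: fun_coloring_star.
Qed.

Lemma star_fun_of_colorable k : triangle_free G ->
  star_edge_colorable G k -> exists f, star_fun (@adj G) k f.
Proof.
by move=> tf /existsP[c cS]; exists (pair_color c); apply: pair_color_star.
Qed.

Lemma star_chromatic_indexE k : triangle_free G ->
    star_edge_colorable G k.+1 -> (forall f, ~ star_fun (@adj G) k f) ->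
  star_chromatic_index G = k.+1.
Proof.
move=> tf col no; rewrite /star_chromatic_index; case: ex_minnP => j cj jmin.
apply/eqP; rewrite eqn_leq jmin //= ltnNge; apply/negP=> jk.
have [f fS] := star_fun_of_colorable tf cj.
exact: no _ (star_fun_mono jk fS).
Qed.
End EdgeColoringFun.

(** * Triangle-freeness of the products *)

(** Two steps in different directions change both coordinates, so a triangle would lie in a copy of
    one factor. *)
Lemma cart_prod_triangle_free (G H : sgraph) :
  triangle_free G -> triangle_free H -> triangle_free (cart_prod G H).
Proof.
move=> tG tH [x x'] [y y'] [z z']; rewrite /= /cart_adj /=.
case/orP=> /andP[]; [move=> xy /eqP-> | move=> /eqP-> xy];
  case/orP=> /andP[]; [move=> yz /eqP-> | move=> /eqP<- yz
    | move=> yz /eqP<- | move=> /eqP-> yz];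
  rewrite ?eqxx ?adj_irrefl ?andbF ?andbT ?orbF /=.
- exact: tG xy yz.
- by rewrite (negPf (adj_neq yz)) (negPf (adj_neq xy)) ?andbF.
- by rewrite (negPf (adj_neq yz)) (negPf (adj_neq xy)) ?andbF.
- exact: tH xy yz.
Qed.

Lemma cycle5_triangle_free : triangle_free (cycle_graph 5).
Proof. by do 3![case=> -[|[|[|[|[|//]]]]] ?]. Qed.

(** Adjacent vertices of a path have opposite parity. *)
Lemma path_triangle_free n : triangle_free (path_graph n).
Proof.
have oddS (i j : 'I_n) : path_adj i j -> odd j = ~~ odd i.
  by case/orP=> /eqP <- //=; rewrite negbK.
move=> x y z /oddS yE /oddS; rewrite yE negbK => zE.
by apply/negP=> /oddS; rewrite zE; case: odd.
Qed.

(** * Backtracking search over equality constraints *)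

(* [(b, (i, j))] is the literal "variables i and j are equal" if [b], and its
   negation otherwise; a clause is a disjunction of literals. *)
Definition literal := (bool * (nat * nat))%type.

(* Conditionals rather than [&&] and [||], [has] and [all]: call-by-value
   evaluation of the latter would not stop early. *)
Fixpoint sat (v : nat -> nat) (cl : seq literal) : bool :=
  if cl is (b, (i, j)) :: cl' then
    if (if eqn (v i) (v j) then b else ~~ b) then true else sat v cl'
  else false.

Fixpoint sat_all (v : nat -> nat) (cls : seq (seq literal)) : bool :=
  if cls is cl :: cls' then if sat v cl then sat_all v cls' else false
  else true.

Fixpoint exists_in (p : pred nat) (s : seq nat) : bool :=
  if s is x :: s' then if p x then true else exists_in p s' else false.

(* [env] lists the values of the variables in reverse order, and the clauses of
   [plan] refer to variables by their position in [env].  As the clauses are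
   invariant under permutations of the values, only the first of the
   values not in [env], namely [used], has to be tried. *)
Fixpoint extensible (k : nat) (plan : seq (seq (seq literal))) (env : seq nat)
    (used : nat) : bool :=
  if plan is cls :: plan' then
    exists_in (fun c => if sat_all (nth 0 (c :: env)) cls
      then extensible k plan' (c :: env) (maxn used c.+1) else false)
      (iota 0 (minn k used.+1))
  else true.

Lemma sat_allE v cls : sat_all v cls = all (sat v) cls.
Proof. by elim: cls => //= cl cls ->; case: ifP. Qed.

Lemma exists_inE p s : exists_in p s = has p s.
Proof. by elim: s => //= x s ->; case: ifP. Qed.

Definition literals_below t (cl : seq literal) :=
  all (fun l => (l.2.1 <= t) && (l.2.2 <= t)) cl.

Lemma sat_inj t v v' cl : {in [pred i | i <= t] &, forall i j,
    (v i == v j) = (v' i == v' j)} ->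
  literals_below t cl -> sat v cl = sat v' cl.
Proof.
move=> vv'; elim: cl => //= -[b [i j]] cl IH /andP[/andP[it jt] /IH->].
by rewrite !eqnE vv'.
Qed.

(** A solution [v] guides the search to success, so a failed search rules out every solution. *)
Lemma extensible_complete k plan env used (v : nat -> nat) :
    (forall i, i < size env + size plan -> v i < k) ->
    (forall i, i < size plan -> all (fun cl => literals_below (size env + i) cl
       && sat (fun j => v (size env + i - j)) cl) (nth [::] plan i)) ->
    (forall j, j < size env -> nth 0 env j = v ((size env).-1 - j)) ->
    all (fun c => c < used) env ->
  extensible k plan env used.
Proof.
elim: plan env used v => //= cls plan IH env used v vk vS vE envU.
rewrite exists_inE; set t := size env.
wlog vt : v vk vS vE / v t < minn k used.+1.
  move=> wl; case: (ltnP (v t) (minn k used.+1)); first exact: wl.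
  have vtk : v t < k by apply: vk; rewrite addnS ltnS leq_addr.
  rewrite geq_min leqNgt vtk /= => uv.
  (* [w] swaps [v t] and [used]. Neither occurs in [env], so the renamed solution still extends
     [env], and it takes the value [used] at [t]. *)
  pose w x := if x == v t then used else if x == used then v t else x.
  have w_inj : injective w.
    move=> x y; rewrite /w; do 2!case: ifP => [/eqP->|/eqP ?];
    do ?case: ifP => [/eqP ->|/eqP ?] //; try (by move=> ?; subst); congruence.
  have uk : used < k by apply: leq_ltn_trans vtk; apply: ltnW.
  apply: (wl (w \o v)).
  - by move=> i /vk vik; rewrite /w /=; case: ifP => // _; case: ifP.
  - move=> i /vS/allP H; apply/allP=> cl /H/andP[lb cS]; rewrite lb /=.
    rewrite (sat_inj _ lb (v' := fun j => v (size env + i - j))) // => ? ? _ _.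
    by rewrite /= (inj_eq w_inj).
  - move=> j jt; rewrite vE //= /w.
    have := all_nthP 0 envU j jt; rewrite vE // => ltu.
    by rewrite !ltn_eqF //; apply: leq_trans ltu (ltnW uv).
  - by rewrite /w /= eqxx leq_min uk ltnSn.
apply/hasP; exists (v t); first by rewrite mem_iota.
have envE j : j < t.+1 -> nth 0 (v t :: env) j = v (t - j).
  case: j => [|j] /=; rewrite ?subn0 // ltnS => /vE->.
  by rewrite -subn1 -subnDA add1n.
rewrite sat_allE ifT; last first.
  apply/allP=> cl cl_in; have /= := vS 0 isT.
  rewrite addn0 => /allP/(_ _ cl_in).
  case/andP=> lb; rewrite (sat_inj _ lb (v' := nth 0 (v t :: env))) //.
  by move=> i j; rewrite !inE => it jt; rewrite !envE.
apply: (IH _ _ v) => //=.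
- by rewrite addSnnS.
- by move=> i ip; have := vS i.+1 ip; rewrite /= addnS addSn.
- rewrite leq_max ltnSn orbT /=; apply: sub_all envU => x xu.
  by rewrite leq_max xu.
Qed.

Definition max_var (cl : seq literal) : nat :=
  foldr (fun l m => maxn (maxn l.2.1 l.2.2) m) 0 cl.

(** A clause is tested as soon as its largest variable [t] gets a value; [t - i] is then the
    position of variable [i] in the reversed [env]. *)
Definition search_plan (n : nat) (cls : seq (seq literal)) :=
  let mcls := [seq (max_var cl, cl) | cl <- cls] in
  [seq [seq [seq (l.1, (t - l.2.1, t - l.2.2)) | l <- mcl.2]
         | mcl <- mcls & eqn mcl.1 t] | t <- iota 0 n].

Lemma max_var_below t cl : max_var cl <= t -> literals_below t cl.
Proof.
by elim: cl => //= l cl IH; rewrite !geq_max -andbA => /and3P[-> -> /IH->].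
Qed.

Lemma search_plan_complete k n cls v :
    (forall i, i < n -> v i < k) -> all (sat v) cls ->
  extensible k (search_plan n cls) [::] 0.
Proof.
move=> vk /allP vS; apply: (extensible_complete (v := v)) => //= i;
  rewrite size_map size_iota add0n => i_n; first exact: vk.
rewrite (nth_map 0) ?size_iota // nth_iota // add0n.
apply/allP=> _ /mapP[[m cl] + ->] /=.
rewrite mem_filter /= eqnE => /andP[/eqP <- {i i_n}/mapP[cl' cl'_in [-> ->]]].
have lb := max_var_below (leqnn (max_var cl')).
have lb' : literals_below (max_var cl')
    [seq (l.1, (max_var cl' - l.2.1, max_var cl' - l.2.2)) | l <- cl'].
  by rewrite /literals_below all_map; apply/allP=> l _ /=; rewrite !leq_subr.
rewrite lb' /=; have := vS _ cl'_in.
move: (max_var cl') lb => t {lb' vS cl'_in}.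
elim: cl' => //= -[b [x y]] cl' IH /= /andP[/andP[xt yt] /IH{}IH].
by rewrite !subKn //; case: ifP.
Qed.

(** * Constraints of a star coloring *)

(** A dart is a directed edge with the index of its edge; opposite darts share this index, hence one
    variable. *)
Definition darts (s : seq (nat * nat)) : seq (nat * nat * nat) :=
  zip s (iota 0 (size s)) ++ zip [seq (e.2, e.1) | e <- s] (iota 0 (size s)).

Definition dart_pairs (s : seq (nat * nat)) :=
  let ds := darts s in
  flatten [seq [seq (d, d') | d' <- ds & if eqn d'.1.1 d.1.2
    then ~~ eqn d'.1.2 d.1.1 else false] | d <- ds].

(** A walk and its reverse give the same clause up to order; the index comparisons keep one of
    them. *)
Definition star_clauses (s : seq (nat * nat)) : seq (seq literal) :=
  let ps := dart_pairs s in
  [seq [:: (false, (p.1.2, p.2.2))] | p <- ps & p.1.2 < p.2.2] ++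
  flatten [seq [seq [:: (false, (p.1.2, q.1.2)); (false, (p.2.2, q.2.2))]
     | q <- ps & if eqn q.1.1.1 p.2.1.2 then
         if eqn q.1.1.2 p.2.1.1 then false else p.1.2 < q.2.2 else false]
     | p <- ps].

Section StarClauses.
Variables (e : rel nat) (k : nat) (f : nat -> nat -> nat) (s : seq (nat * nat)).
Hypotheses (e_sym : symmetric e) (fS : star_fun e k f).
Hypothesis s_e : all (fun d => e d.1 d.2) s.

Definition edge_values (i : nat) : nat :=
  f (nth (0, 0) s i).1 (nth (0, 0) s i).2.

Lemma dartsP d : d \in darts s ->
  e d.1.1 d.1.2 /\ f d.1.1 d.1.2 = edge_values d.2.
Proof.
case: fS => fC _ _ _; rewrite mem_cat => /orP[]/(nthP ((0, 0), 0))[i];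
  rewrite size_zip size_iota ?size_map minnn => i_s <-;
  rewrite nth_zip ?size_map ?size_iota //= nth_iota //; last first.
- rewrite (nth_map (0, 0)) //= add0n; have := allP s_e _ (mem_nth (0, 0) i_s).
  by move=> ei; rewrite e_sym ei fC // e_sym.
by have := allP s_e _ (mem_nth (0, 0) i_s).
Qed.

Lemma dart_pairsP p : p \in dart_pairs s ->
  [/\ p.1 \in darts s, p.2 \in darts s, p.2.1.1 = p.1.1.2
    & p.1.1.1 != p.2.1.2].
Proof.
case/flatten_mapP=> d d_in /mapP[d' + ->]; rewrite mem_filter /=.
by case: eqnP => //= -> /andP[]; rewrite eqnE eq_sym.
Qed.

Lemma star_clauses_sat : all (sat edge_values) (star_clauses s).
Proof.
case: (fS) => fC _ fP fQ; rewrite all_cat; apply/andP; split.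
  apply/allP=> _ /mapP[[[[x y] i] [[y' z] j]] + ->]; rewrite mem_filter.
  case/andP=> _ /dart_pairsP[/dartsP/=[xy <-] /dartsP/=[+ <-] yy'].
  by rewrite {}yy' => yz xz; rewrite eqnE (negPf (fP _ _ _ xy yz xz)).
apply/allP=> cl /flatten_mapP[[[[x y] i] [[y' z] j]]].
case/dart_pairsP=> /dartsP/=[xy fi] /dartsP/=[+ fj] yy'; rewrite {}yy' in fj *.
move=> yz xz /mapP[[[[z' u] i'] [[u' v] j']] + ->]; rewrite mem_filter /=.
case: eqnP => // ->; case: eqnP => // /eqP uy /andP[_].
case/dart_pairsP=> /dartsP/=[zu fi'] /dartsP/=[+ fj'] uu'.
rewrite {}uu' in fj' *.
move=> uv zv; rewrite -fi -fj -fi' -fj' !eqnE.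
case: eqP => //= ff; rewrite (negPf (fQ _ _ _ _ _ xy yz zu uv _ _ _ ff)) //.
by rewrite eq_sym.
Qed.

Lemma star_fun_extensible extra : all (sat edge_values) extra ->
  extensible k (search_plan (size s) (extra ++ star_clauses s)) [::] 0.
Proof.
case: (fS) => _ fk _ _ eS; apply: (@search_plan_complete _ _ _ edge_values).
  by move=> i i_s; apply/fk/(allP s_e)/mem_nth.
by rewrite all_cat eS star_clauses_sat.
Qed.
End StarClauses.

(** * Products with numeric coordinates and a coloring checker *)

Definition cyc_rel m : rel nat :=
  fun i j => (i.+1 %% m == j) || (j.+1 %% m == i).

Definition path_rel : rel nat := fun i j => (i.+1 == j) || (j.+1 == i).

Definition box (m n : nat) (r r' : rel nat) : rel (nat * nat) := fun x y =>
  [&& x.1 < m, x.2 < n, y.1 < m, y.2 < n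
    & r x.1 y.1 && (x.2 == y.2) || (x.1 == y.1) && r' x.2 y.2].

Section Box.
Variables (m n : nat) (r r' : rel nat).

Definition box_vertices : seq (nat * nat) :=
  [seq (i, l) | i <- iota 0 m, l <- iota 0 n].

Definition box_nbrs x := [seq y <- box_vertices | box m n r r' x y].

Lemma box_nbrsP x y :
  box m n r r' x y -> (x \in box_vertices) && (y \in box_nbrs x).
Proof.
move=> xy; rewrite mem_filter xy /=.
case: x y xy => [i l] [i' l'] /and5P[/= im ln im' ln' _].
by apply/andP; split; apply: allpairs_f; rewrite mem_iota.
Qed.

Definition star_check k (f : nat * nat -> nat * nat -> nat) : bool :=
  all (fun x => all (fun y =>
    [&& f x y == f y x, f x y < k &
      all (fun z => (f x y != f y z) &&
        all (fun u => all (fun v => f y z != f u v)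
          [seq v <- box_nbrs u | z != v])
        [seq u <- box_nbrs z | (y != u) && (f x y == f z u)])
      [seq z <- box_nbrs y | x != z]]) (box_nbrs x)) box_vertices.

Lemma star_checkP k f : star_check k f -> star_fun (box m n r r') k f.
Proof.
move=> /allP ck.
have {}ck x y : box m n r r' x y -> _ :=
  fun xy => let: conj a b := andP (box_nbrsP xy) in allP (ck x a) y b.
split.
- by move=> x y /ck/and3P[/eqP].
- by move=> x y /ck/and3P[].
- move=> x y z /ck/and3P[_ _ /allP H] /box_nbrsP/andP[_ yz] xz.
  by have := H z; rewrite mem_filter xz yz => /(_ isT)/andP[].
move=> x y z u v /ck/and3P[_ _ /allP H] /box_nbrsP/andP[_ yz].
move=> /box_nbrsP/andP[_ zu] /box_nbrsP/andP[_ uv] xz yu zv E.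
have := H z; rewrite mem_filter xz yz => /(_ isT)/andP[_] /allP/(_ u).
rewrite mem_filter yu E eqxx => /(_ zu)/allP/(_ v).
by rewrite mem_filter zv => /(_ uv).
Qed.
End Box.

(** * Explicit colorings and the upper bounds *)

(* Entry [i] of row [l] of [h] (resp. [w]) is the color of the edge from
   [(i, l)] to [(i + 1, l)] (resp. [(i, l + 1)]), coordinates being taken
   modulo 5 and [p]. *)
Definition table_color (p : nat) (h w : seq (seq nat)) (x y : nat * nat) :=
  let entry t z := nth 0 (nth [::] t z.2) z.1 in
  if x.2 == y.2 then entry h (if x.1.+1 %% 5 == y.1 then x else y)
  else entry w (if x.2.+1 %% p == y.2 then x else y).

Lemma star_fun_C5P6 : exists f, star_fun (box 5 6 (cyc_rel 5) path_rel) 6 f.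
Proof.
(* The modulus 7 exceeds [l + 1] for each of the layers 0 to 5, so the vertical coordinate never
   wraps around. *)
exists (table_color 7
  [:: [:: 3; 1; 5; 0; 2]; [:: 4; 1; 3; 2; 0]; [:: 1; 2; 5; 3; 2];
      [:: 2; 4; 2; 3; 5]; [:: 4; 1; 0; 2; 3]; [:: 4; 3; 2; 0; 5]]
  [:: [:: 5; 0; 2; 4; 1]; [:: 3; 5; 4; 0; 5]; [:: 0; 3; 0; 1; 4];
      [:: 1; 5; 3; 5; 0]; [:: 2; 0; 5; 4; 1]]).
by apply: star_checkP; vm_compute.
Qed.

Lemma star_fun_C5C3 : exists f, star_fun (box 5 3 (cyc_rel 5) (cyc_rel 3)) 7 f.
Proof.
exists (table_color 3
  [:: [:: 0; 1; 0; 2; 3]; [:: 5; 2; 3; 0; 6]; [:: 1; 5; 2; 3; 5]]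
  [:: [:: 2; 3; 4; 5; 1]; [:: 0; 4; 6; 1; 4]; [:: 4; 6; 3; 4; 6]]).
by apply: star_checkP; vm_compute.
Qed.

Local Notation C5P n := (cart_prod (cycle_graph 5) (path_graph n)).

Lemma C5P_triangle_free n : triangle_free (C5P n).
Proof.
exact/cart_prod_triangle_free/path_triangle_free/cycle5_triangle_free.
Qed.

Lemma C5P_colorable_6 n : n <= 6 -> star_edge_colorable (C5P n) 6.
Proof.
move=> n6; have [f fS] := star_fun_C5P6; apply: star_edge_colorable_of_fun.
pose h (x : C5P n) := (nat_of_ord x.1, nat_of_ord x.2).
apply: (star_fun_pullback (h := h) _ _ fS).
  move=> [i l] [j l'] /orP[]/andP[/= ij ll']; rewrite /box /= !ltn_ord /=;
    rewrite !(leq_trans (ltn_ord _) n6) /=.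
    by case/andP: ij => _; rewrite /cyc_rel => ->; rewrite (eqP ll') eqxx.
  rewrite (eqP ij) eqxx; move: ll'.
  by rewrite /= /path_adj /path_rel => ->; rewrite orbT.
move=> [i l] _ [j l'] _ _; apply: contraNneq => -[/val_inj-> /val_inj->] //.
Qed.

Lemma modSn p a : (a %% p).+1 = a.+1 %[mod p].
Proof. by rewrite -addn1 modnDml addn1. Qed.

Lemma mod3_SS a : (a.+2 == a %[mod 3]) = false.
Proof. by rewrite -addn2 -[X in _ == X %[mod _]]addn0 eqn_modDl. Qed.

(** Reducing layers modulo 3 is locally injective: the neighbors [l - 1] and [l + 1] of [l] differ
    by 2. *)
Lemma C5P_colorable_7 n : star_edge_colorable (C5P n) 7.
Proof.
have [f fS] := star_fun_C5C3; apply: star_edge_colorable_of_fun.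
pose h (x : C5P n) := (nat_of_ord x.1, nat_of_ord x.2 %% 3).
apply: (star_fun_pullback (h := h) _ _ fS).
  move=> [i l] [j l'] /orP[]/andP[/= ij ll'];
    rewrite /box /= !ltn_ord !ltn_mod /=.
    by case/andP: ij => _; rewrite /cyc_rel => ->; rewrite (eqP ll') eqxx.
  rewrite (eqP ij) eqxx /cyc_rel; move: ll'; rewrite /= /path_adj.
  by case/orP=> /eqP <-; rewrite !modSn eqxx ?orbT.
move=> [i l] [j l'] [i' l''] xy yz; apply: contraNneq => -[E E'].
have ii : i = i' by apply: val_inj.
rewrite ii; suff -> : l = l'' by [].
apply/val_inj.
case/orP: xy => /andP[/= ij ll']; case/orP: yz => /andP[/= ij' ll''].
- by rewrite (eqP ll') (eqP ll'').
- by move: ij; rewrite ii (eqP ij') /cycle_adj eqxx.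
- by move: ij'; rewrite -ii (eqP ij) /cycle_adj eqxx.
case/orP: ll' => /eqP ll'; case/orP: ll'' => /eqP ll''.
- by move/eqP: E'; rewrite -ll'' -ll' eq_sym mod3_SS.
- by apply/succn_inj; rewrite ll' ll''.
- by rewrite -ll' -ll''.
- by move/eqP: E'; rewrite -ll' -ll'' mod3_SS.
Qed.

(** * The four exhaustive searches *)

(* Vertex [(i, l)] of C_5 x P_m is coded as [5 * l + i].  The edge orders below
   were found by a randomized greedy minimization of the size of the search
   tree; they start with the edges of the middle layer, the five edges with
   indices 0 to 4 to which the clauses [repeat_clauses], [distinct_clauses],
   [fresh_clauses] and [closed_clauses] refer.  In [order_fresh] index 5 is the
   upward edge at vertex 0 of this layer, and in [order_closed] indices 5 to 14
   are the ten edges leaving it. *)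
Definition order_P3 : seq (nat * nat) :=
  [:: (5, 6); (6, 7); (7, 8); (8, 9); (9, 5); (0, 5); (5, 10); (2, 7); (7, 12);
      (3, 8); (8, 13); (1, 6); (1, 2); (0, 1); (2, 3); (6, 11); (10, 11);
      (11, 12); (3, 4); (4, 0); (4, 9); (9, 14); (12, 13); (13, 14); (14, 10)].

Definition order_repeat : seq (nat * nat) :=
  [:: (15, 16); (16, 17); (17, 18); (18, 19); (19, 15); (10, 15); (15, 20);
      (18, 23); (13, 18); (12, 17); (12, 13); (11, 12); (11, 16); (10, 11);
      (6, 11); (7, 12); (17, 22); (16, 21); (20, 21); (21, 22); (22, 23);
      (22, 27); (21, 26); (23, 24); (24, 20); (19, 24); (24, 29); (14, 19);
      (14, 10); (13, 14); (20, 25); (23, 28); (8, 13); (5, 10); (9, 14); (9, 5);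
      (8, 9); (5, 6); (6, 7); (7, 8); (2, 7); (4, 9); (3, 8); (0, 5); (1, 6);
      (28, 29); (27, 28); (26, 27); (25, 26); (29, 25); (26, 31)].

Definition order_fresh : seq (nat * nat) :=
  [:: (10, 11); (11, 12); (12, 13); (13, 14); (14, 10); (10, 15); (5, 10);
      (13, 18); (9, 5); (9, 14); (8, 9); (8, 13); (4, 9); (14, 19); (18, 19);
      (19, 15); (19, 24); (7, 8); (7, 12); (12, 17); (17, 18); (18, 23); (3, 8);
      (11, 16); (15, 16); (16, 17); (16, 21); (6, 11); (6, 7); (5, 6); (1, 6);
      (0, 5); (2, 7); (17, 22); (15, 20); (3, 4); (2, 3); (4, 0); (0, 1);
      (1, 2); (21, 22); (22, 23); (23, 24)].

Definition order_closed : seq (nat * nat) :=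
  [:: (10, 11); (11, 12); (12, 13); (13, 14); (14, 10); (10, 5); (10, 15);
      (12, 7); (12, 17); (13, 8); (13, 18); (11, 6); (11, 16); (14, 9);
      (14, 19); (5, 6); (6, 7); (7, 8); (8, 9); (9, 5); (0, 5); (2, 7); (3, 8);
      (1, 6); (4, 9); (0, 1); (1, 2); (2, 3); (3, 4); (4, 0); (15, 16);
      (16, 17); (17, 18); (18, 19)].

Definition repeat_clauses : seq (seq literal) := [:: [:: (true, (0, 2))]].

Definition distinct_clauses : seq (seq literal) :=
  [seq [:: (false, (i, j))] | j <- iota 0 5, i <- iota 0 j].

Definition fresh_clauses : seq (seq literal) :=
  [seq [:: (false, (i, 5))] | i <- iota 0 5].

Definition closed_clauses : seq (seq literal) :=
  [seq [seq (true, (i, j)) | i <- iota 0 5] | j <- iota 5 10].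

Definition colorings_exist k s extra : bool :=
  extensible k (search_plan (size s) (extra ++ star_clauses s)) [::] 0.

Lemma search_P3 : colorings_exist 5 order_P3 [::] = false.
Proof. by vm_compute. Qed.

Lemma search_repeat : colorings_exist 6 order_repeat repeat_clauses = false.
Proof. by vm_compute. Qed.

Lemma search_fresh :
  colorings_exist 6 order_fresh (distinct_clauses ++ fresh_clauses) = false.
Proof. by vm_compute. Qed.

Lemma search_closed :
  colorings_exist 6 order_closed (distinct_clauses ++ closed_clauses) = false.
Proof. by vm_compute. Qed.

(** * Consequences of the searches for star functions *)

Definition code_adj m : rel nat := fun v w =>
  box 5 m (cyc_rel 5) path_rel (v %% 5, v %/ 5) (w %% 5, w %/ 5).

Lemma code_adj_sym m : symmetric (code_adj m).
Proof.
move=> v w; rewrite /code_adj /box /cyc_rel /path_rel /=.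
rewrite (eq_sym (v %/ 5) (w %/ 5)) (eq_sym (v %% 5) (w %% 5)).
rewrite (orbC (_ == w %% 5)) (orbC (_ == w %/ 5)) !andbA.
by congr andb; rewrite -!andbA; do !bool_congr.
Qed.

Lemma star_fun_search m k f s extra : star_fun (code_adj m) k f ->
    all (fun d => code_adj m d.1 d.2) s -> all (sat (edge_values f s)) extra ->
  colorings_exist k s extra.
Proof.
by move=> fS sE eS; apply: star_fun_extensible fS sE _ eS; apply: code_adj_sym.
Qed.

Lemma satE v cl : sat v cl = has (fun l => (v l.2.1 == v l.2.2) == l.1) cl.
Proof.
elim: cl => //= -[b [i j]] cl -> /=; rewrite eqnE.
by case: (v i == v j) b => -[].
Qed.

Lemma no_star_fun_P3 f : ~ star_fun (code_adj 3) 5 f.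
Proof.
move=> fS; have := @star_fun_search 3 5 f order_P3 [::] fS.
by rewrite search_P3 => /(_ isT isT).
Qed.

(** The two edges are edges 0 and 2 of layer 3, the middle one of seven. *)
Lemma no_star_fun_repeat f : star_fun (code_adj 7) 6 f -> f 15 16 != f 17 18.
Proof.
move=> fS; apply/eqP=> ff.
have := star_fun_search (extra := repeat_clauses) fS _ _.
move/(_ order_repeat isT); rewrite search_repeat => /(_ _)/negP; apply=> //.
by rewrite /= /edge_values /= ff eqnE eqxx.
Qed.

Definition mid_colors (f : nat -> nat -> nat) : seq nat :=
  [:: f 10 11; f 11 12; f 12 13; f 13 14; f 14 10].

Lemma distinct_clauses_sat v s : size s = 5 -> uniq s ->
  (forall i, i < 5 -> v i = nth 0 s i) -> all (sat v) distinct_clauses.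
Proof.
move=> sz us vE; apply/allP=> _ /allpairsPdep[j [i [+ + ->]]].
rewrite satE !mem_iota /= !add0n orbF => j5 ij.
have i5 := ltn_trans ij j5; rewrite !vE // nth_uniq ?sz //.
by rewrite (ltn_eqF ij).
Qed.

Lemma no_star_fun_fresh f : star_fun (code_adj 5) 6 f ->
  uniq (mid_colors f) -> f 10 15 \in mid_colors f.
Proof.
move=> fS fU; apply/negPn/negP=> fN.
have := star_fun_search (extra := distinct_clauses ++ fresh_clauses) fS _ _.
move/(_ order_fresh isT); rewrite search_fresh => /(_ _)/negP; apply=> //.
have vE i : i < 5 -> edge_values f order_fresh i = nth 0 (mid_colors f) i.
  by case: i => [|[|[|[|[|]]]]].
rewrite all_cat; apply/andP; split; first exact: distinct_clauses_sat fU vE.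
apply/allP=> _ /mapP[i + ->].
rewrite satE mem_iota /= orbF => i5; rewrite vE // eqbF_neg.
apply: contraNneq fN => E.
by rewrite -[f 10 15]E mem_nth.
Qed.

Lemma no_star_fun_closed f : star_fun (code_adj 5) 6 f -> uniq (mid_colors f) ->
  exists2 i, i < 5 & (f (10 + i) (15 + i) \notin mid_colors f)
    || (f (10 + i) (5 + i) \notin mid_colors f).
Proof.
move=> fS fU.
suff /hasP[i] : has (fun i => (f (10 + i) (15 + i) \notin mid_colors f)
    || (f (10 + i) (5 + i) \notin mid_colors f)) (iota 0 5).
  by rewrite mem_iota => i5 H; exists i.
apply/negPn/negP=> /hasPn fN.
have {}fN i : i < 5 -> (f (10 + i) (15 + i) \in mid_colors f)
    && (f (10 + i) (5 + i) \in mid_colors f).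
  by move=> i5; have := fN i; rewrite mem_iota negb_or !negbK => /(_ i5).
have := star_fun_search (extra := distinct_clauses ++ closed_clauses) fS _ _.
move/(_ order_closed isT); rewrite search_closed => /(_ _)/negP; apply=> //.
have vE i : i < 5 -> edge_values f order_closed i = nth 0 (mid_colors f) i.
  by case: i => [|[|[|[|[|]]]]].
rewrite all_cat; apply/andP; split; first exact: distinct_clauses_sat fU vE.
apply/allP=> _ /mapP[j + ->].
rewrite satE mem_iota => j5.
(* Indices 5 to 14 are exactly the ten edges treated by [fN]. *)
have : edge_values f order_closed j \in mid_colors f.
  case/andP: (fN 0 isT) (fN 1 isT) (fN 2 isT) (fN 3 isT) (fN 4 isT).
  move=> ? ? /andP[? ?] /andP[? ?] /andP[? ?] /andP[? ?].
  by move: j j5; do 15!case=> //.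
case/(nthP 0)=> i i5 E; rewrite has_map; apply/hasP; exists i.
  by rewrite mem_iota.
by rewrite /= vE // E eqxx.
Qed.

(** * Copies of C_5 x P_m inside longer products *)

Definition C5P_vertex n (i l : nat) : C5P n.+1 := (inord (i %% 5), inord l).

Lemma C5P_vertex_mod n i j l :
  i = j %[mod 5] -> C5P_vertex n i l = C5P_vertex n j l.
Proof. by rewrite /C5P_vertex => ->. Qed.

Section Place.
(* Codes of C_5 x P_m are placed in layers [o] to [o + m - 1] of C_5 x P_n.+1,
   rotated by [r], and upside down if [b]. *)
Variables (n m r o : nat) (b : bool).
Hypothesis om : o + m <= n.+1.

Definition layer l := if b then o + (m.-1 - l) else o + l.

Definition place (v : nat) : C5P n.+1 := C5P_vertex n (v + r) (layer (v %/ 5)).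

Lemma layer_lt l : l < m -> layer l < n.+1.
Proof.
move=> lm; apply: leq_trans om; rewrite /layer; case: b; rewrite ltn_add2l //.
by case: m lm => // m' _; rewrite ltnS leq_subr.
Qed.

Lemma layer_inj l l' : l < m -> l' < m -> layer l = layer l' -> l = l'.
Proof.
rewrite /layer; case: m => // m' lm lm'; case: b => /addnI //= E.
by rewrite -(@subKn l m') // E subKn.
Qed.

Lemma layerS l : l.+1 < m -> path_rel (layer l) (layer l.+1).
Proof.
rewrite /layer /path_rel; case: m => // m' lm.
case: b; rewrite -!addnS ?eqxx //=.
by rewrite subnSK // eqxx orbT.
Qed.

Lemma place_adj v w : code_adj m v w -> adj (place v) (place w).
Proof.
(* By symmetry the edge is traversed in the direction of increasing coordinate, modulo 5 within a
   layer. *)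
wlog: v w / (v.+1 == w %[mod 5]) && (v %/ 5 == w %/ 5)
     || (v == w %[mod 5]) && ((v %/ 5).+1 == w %/ 5).
  move=> wl vw; have /and5P[_ _ _ _ E] := vw.
  rewrite /= /cyc_rel /path_rel /= !modSn in E.
  case/orP: E => /andP[]; last first.
    move=> vw5 /orP[] H; first by apply: wl; rewrite // vw5 H orbT.
    rewrite adj_sym; apply: wl; rewrite 1?code_adj_sym //.
    by rewrite (eq_sym (w %% 5)) vw5 H orbT.
  case/orP=> H vw5; first by apply: wl; rewrite // vw5 H.
  rewrite adj_sym; apply: wl; rewrite 1?code_adj_sym //.
  by rewrite H (eq_sym (w %/ 5)) vw5.
move=> H; case/and5P=> _ /= vm _ wm _; case/orP: H => /andP[Hi /eqP Hl].
  apply/orP; left; rewrite /= Hl eqxx andbT /cycle_adj.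
  rewrite -(inj_eq val_inj) /= !inordK ?ltn_mod // modSn -addSn !eqn_modDr.
  rewrite Hi andbT.
  apply/eqP=> E; move: Hi.
  by rewrite -modSn E modSn -addn1 -[X in _ == X %[mod _]]addn0 eqn_modDl.
have Ei : v + r = w + r %[mod 5] by apply/eqP; rewrite eqn_modDr.
apply/orP; right; rewrite /= Ei eqxx /path_adj !inordK ?layer_lt //= -Hl.
by apply: layerS; rewrite Hl.
Qed.

Lemma place_inj u v w : code_adj m u v -> code_adj m v w -> u != w ->
  place u != place w.
Proof.
case/and5P=> _ /= um _ _ _; case/and5P=> _ _ _ /= wm _.
apply: contraNneq => -[/(congr1 val) /= + /(congr1 val) /=].
rewrite !inordK ?ltn_mod ?layer_lt // => /eqP; rewrite eqn_modDr => /eqP Ei El.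
by rewrite (divn_eq u 5) (divn_eq w 5) Ei (layer_inj _ _ El).
Qed.

Lemma place_star k f : star_fun (@adj (C5P n.+1)) k f ->
  star_fun (code_adj m) k (fun v w => f (place v) (place w)).
Proof. exact: star_fun_pullback place_adj place_inj. Qed.
End Place.

(** * Lower bounds and the conclusion *)

Lemma no_star_fun_5 n f : 3 <= n -> ~ star_fun (@adj (C5P n)) 5 f.
Proof.
case: n f => // n f n3 fS.
exact: no_star_fun_P3 (place_star (o := 0) 0 false n3 fS).
Qed.

(** Two edges of a 5-cycle are either adjacent, and properness applies, or two steps apart, as in
    the hypotheses. *)
Lemma mid_colors_uniq k f : star_fun (code_adj 5) k f ->
    f 10 11 != f 12 13 -> f 11 12 != f 13 14 -> f 12 13 != f 14 10 ->
    f 13 14 != f 10 11 -> f 14 10 != f 11 12 ->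
  uniq (mid_colors f).
Proof.
case=> _ _ fP _; rewrite /= !inE !negb_or => -> -> -> n30 n41.
rewrite eq_sym in n30; rewrite eq_sym in n41; rewrite n30 n41.
by rewrite !fP // eq_sym fP.
Qed.

Lemma no_star_fun_6 n f : 7 <= n -> ~ star_fun (@adj (C5P n)) 6 f.
Proof.
case: n f => // n f n7 fS.
(* [H i] is the color of edge [i] of layer 3, and [W b i] that of the edge leaving its vertex [i],
   downwards if [b] and upwards otherwise. *)
pose V := C5P_vertex n; pose H i := f (V i 3) (V i.+1 3).
pose W b i := f (V i 3) (V i (if b then 2 else 4)).
have VE i j l : i = j %[mod 5] -> V i l = V j l by apply: C5P_vertex_mod.
have HE i j : i = j %[mod 5] -> H i = H j.
  by move=> ij; rewrite /H (VE i j) // (VE i.+1 j.+1) // -modSn ij modSn.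
have WE b i j : i = j %[mod 5] -> W b i = W b j.
  by move=> ij; rewrite /W !(VE i j).
(* The search for a repeated color, rotated by [i], uses layers 0 to 6. *)
have H2 i : H i != H i.+2.
  have := no_star_fun_repeat (place_star (o := 0) i false n7 fS).
  by rewrite (HE i (15 + i)) ?(HE i.+2 (17 + i)) // modnDl.
(* The other two searches use layers 1 to 5, whose middle layer is again 3, even upside down. *)
have n6 : 1 + 5 <= n.+1 by apply: leq_trans n7.
pose g r b v w := f (place n 5 r 1 b v) (place n 5 r 1 b w).
have gS r b : star_fun (code_adj 5) 6 (g r b) by apply: place_star.
have gH r b : mid_colors (g r b) = [seq H (i + r) | i <- iota 10 5].
  have L : layer 5 1 b 2 = 3 by case: (b).
  have E : V (10 + r) 3 = V (15 + r) 3 by apply: VE; rewrite -modnDml.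
  have E' : f (V (14 + r) 3) (V (10 + r) 3) = H (14 + r) by rewrite E.
  rewrite /mid_colors /g /place -[10 %/ 5]/2 -[11 %/ 5]/2 -[12 %/ 5]/2.
  by rewrite -[13 %/ 5]/2 -[14 %/ 5]/2 L -/V E'.
have gW r b : g r b 10 15 = W b r.
  have L : layer 5 1 b 2 = 3 by case: (b).
  have L' : layer 5 1 b 3 = if b then 2 else 4 by case: (b).
  rewrite /g /place -[10 %/ 5]/2 -[15 %/ 5]/3 L L' -/V -(WE b (10 + r)).
    by rewrite /W (VE (15 + r) (10 + r)) // -modnDml.
  by rewrite -modnDml.
have gU r b : uniq (mid_colors (g r b)).
  have [E0 E1 E2 E3 E4] := gH r b.
  by apply: mid_colors_uniq (gS r b) _ _ _ _ _;
    rewrite ?E0 ?E1 ?E2 ?E3 ?E4 ?H2.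
(* A rotation and possibly a flip turn any edge leaving layer 3 into the upward edge at vertex 0, so
   no such edge has a color outside the layer. *)
have midW b i : W b i \in mid_colors (g 0 false).
  rewrite -gW; have := no_star_fun_fresh (gS i b) (gU i b).
  rewrite !gH => /mapP[j _ ->]; apply/mapP; exists (10 + (j + i) %% 5).
    by rewrite mem_iota leq_addr ltn_add2l ltn_mod.
  by apply: HE; rewrite addn0 modnDmr -[RHS]modnDml.
have [i i5] := no_star_fun_closed (gS 0 false) (gU 0 false).
have -> : g 0 false (10 + i) (15 + i) = W false i.
  by rewrite -gW; move: i i5; do 5!case=> //.
have -> : g 0 false (10 + i) (5 + i) = W true i.
  by rewrite -gW; move: i i5; do 5!case=> //.
by rewrite !midW.
Qed.

Theorem theorem23 (n : nat) (hn : 3 <= n) :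
  (n \in [:: 3; 4; 5; 6] ->
     star_chromatic_index (cart_prod (cycle_graph 5) (path_graph n)) = 6) /\
  (7 <= n ->
     star_chromatic_index (cart_prod (cycle_graph 5) (path_graph n)) = 7).
Proof.
have tf := @C5P_triangle_free n; split=> [n36|n7].
  apply: star_chromatic_indexE tf _ _; last by move=> f; apply: no_star_fun_5.
  by apply: C5P_colorable_6; move: n36; rewrite !inE => /or4P[] /eqP->.
apply: star_chromatic_indexE tf _ _; first exact: C5P_colorable_7.
by move=> f; apply: no_star_fun_6.
Qed.
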